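(* Let $\mathcal D=(\mathcal T,\Psi)$ be a Markov Trace Model with $\mathcal T\ne\emptyset$. Then $\mathcal D$ has a uniform stationary distribution (i.e. $S(\mathcal T)$ is finite and the uniform distribution on $S(\mathcal T)$ is stationary for $\mathcal D$) if and only if $\mathcal D$ is both uniformly selective and balanced.
   Context: Fix a set of points (a metric space) $X$. A trace is a finite sequence $T=(T(0),\dots,T(|T|-1))$ of at least two points of $X$ (not necessarily distinct); $|T|$ is the number of its points, $T_{start}=T(0)$, $T_{end}=T(|T|-1)$. For a (possibly infinite) set of traces $\mathcal T$: $\mathcal T^{\mathrm{out}}(u)=\{T\in\mathcal T: T_{start}=u\}$, $\mathcal T^{\mathrm{in}}(u)=\{T\in\mathcal T: T_{end}=u\}$, $P(\mathcal T)=\{u\in X:\mathcal T^{\mathrm{out}}(u)\ne\emptyset\}$, $S(\mathcal T)=\{\langle T,i\rangle: T\in\mathcal T,\ 1\le i\le |T|-1\}$. $\mathcal T$ is endless if for every $T\in\mathcal T$ there is $T'\in\mathcal T$ with $T'_{start}=T_{end}$. A Markov Trace Model (MTM) is a pair $\mathcal D=(\mathcal T,\Psi)$ where $\mathcal T$ is an endless set of traces with $|P(\mathcal T)|<\infty$ and $\Psi=\{\psi_u\}_{u\in P(\mathcal T)}$ with $\psi_u$ a (discrete) probability distribution over $\mathcal T^{\mathrm{out}}(u)$. It determines a Markov chain $\mathcal M_{\mathcal D}$ with state space $S(\mathcal T)$ and transition probabilities: $\Pr(\langle T,i\rangle\to\langle T,i+1\rangle)=1$ for $1\le i<|T|-1$;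 $\Pr(\langle T,|T|-1\rangle\to\langle T',1\rangle)=\psi_{T_{end}}(T')$ for $T'\in\mathcal T^{\mathrm{out}}(T_{end})$; all other transition probabilities are $0$. A stationary distribution of $\mathcal D$ is a stationary probability distribution of $\mathcal M_{\mathcal D}$. $\mathcal D$ is uniformly selective if for every $u\in P(\mathcal T)$, $\psi_u$ is the uniform distribution on $\mathcal T^{\mathrm{out}}(u)$ (in particular $\mathcal T^{\mathrm{out}}(u)$ is finite). $\mathcal D$ is balanced if $|\mathcal T^{\mathrm{in}}(u)|=|\mathcal T^{\mathrm{out}}(u)|$ for every $u\in P(\mathcal T)$. *)

(* Defs.v *)
From mathcomp Require Import all_boot all_order all_algebra finmap.
From mathcomp Require Import all_classical all_reals all_analysis.

Set Implicit Arguments.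
Unset Strict Implicit.
Unset Printing Implicit Defensive.

Import Order.TTheory GRing.Theory Num.Theory.

Local Open Scope classical_set_scope.
Local Open Scope card_scope.
Local Open Scope ring_scope.

(* A trace [existT _ n t] has n + 2 points, so the bound |T| >= 2 is built into
   the type; T(i) is [tnth t i]. *)
Definition trace (X : choiceType) : choiceType :=
  {n : nat & n.+2.-tuple X} : choiceType.

Definition trace_size (X : choiceType) (T : trace X) : nat := (tag T).+2.

Definition trace_start (X : choiceType) (T : trace X) : X :=
  tnth (tagged T) ord0.

Definition trace_end (X : choiceType) (T : trace X) : X :=
  tnth (tagged T) ord_max.

Definition traces_out (X : choiceType) (TT : set (trace X)) (u : X) :
  set (trace X) := [set T | TT T /\ trace_start T = u].

Definition traces_in (X : choiceType) (TT : set (trace X)) (u : X) :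
  set (trace X) := [set T | TT T /\ trace_end T = u].

Definition endpoints (X : choiceType) (TT : set (trace X)) : set X :=
  [set u | traces_out TT u !=set0].

Definition states (X : choiceType) (TT : set (trace X)) :
  set (trace X * nat) :=
  [set s | TT s.1 /\ (1 <= s.2 <= (trace_size s.1).-1)%N].

Definition endless (X : choiceType) (TT : set (trace X)) : Prop :=
  forall T, TT T -> exists2 T', TT T' & trace_start T' = trace_end T.

(* Only the values of p on A are meaningful.  A may be uncountable: [esum] is
   the supremum of the finite partial sums. *)
Definition discrete_dist (R : realType) (I : choiceType) (A : set I)
  (p : I -> R) : Prop :=
  (forall i, A i -> 0 <= p i) /\ \esum_(i in A) (p i)%:E = 1%E.

(* The mass function of the uniform distribution on A, meaningful only when A
   is finite: [fset_set A] is empty otherwise. *)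
Definition uniform_mass (R : realType) (I : choiceType) (A : set I) (i : I) :
  R := (i \in A)%:R / (#|` fset_set A |%fset)%:R.

(* [mtm_psi u T], total in both arguments, is only constrained, and only
   used, for u in P(TT) and T in TT^out(u). *)
Record MTM (R : realType) (X : choiceType) := {
  mtm_traces : set (trace X);
  mtm_psi : X -> trace X -> R;
  mtm_endless : endless mtm_traces;
  mtm_finite : finite_set (endpoints mtm_traces);
  mtm_dist : forall u, endpoints mtm_traces u ->
    discrete_dist (traces_out mtm_traces u) (mtm_psi u)
}.

(* Only meaningful for s and s' in [states]. *)
Definition mtm_trans (R : realType) (X : choiceType) (D : MTM R X)
  (s s' : trace X * nat) : R :=
  if (s.2 < (trace_size s.1).-1)%N then (s' == (s.1, s.2.+1))%:R
  else if (s'.1 \in traces_out (mtm_traces D) (trace_end s.1)) && (s'.2 == 1%N)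
  then mtm_psi D (trace_end s.1) s'.1
  else 0.

Definition stationary (R : realType) (X : choiceType) (D : MTM R X)
  (p : trace X * nat -> R) : Prop :=
  discrete_dist (states (mtm_traces D)) p /\
  forall s', states (mtm_traces D) s' ->
    \esum_(s in states (mtm_traces D)) (p s * mtm_trans D s s')%:E = (p s')%:E.

Definition has_uniform_stationary (R : realType) (X : choiceType)
  (D : MTM R X) : Prop :=
  finite_set (states (mtm_traces D)) /\
  stationary D (uniform_mass R (states (mtm_traces D))).

Definition uniformly_selective (R : realType) (X : choiceType)
  (D : MTM R X) : Prop :=
  forall u, endpoints (mtm_traces D) u ->
    finite_set (traces_out (mtm_traces D) u) /\
    forall T, traces_out (mtm_traces D) u T ->
      mtm_psi D u T = uniform_mass R (traces_out (mtm_traces D) u) T.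

Definition balanced (R : realType) (X : choiceType) (D : MTM R X) : Prop :=
  forall u, endpoints (mtm_traces D) u ->
    traces_in (mtm_traces D) u #= traces_out (mtm_traces D) u.

(* Main.v *)
(** At an initial state (T, 1) with T starting at u, the constant mass c is
    stationary iff |T^in(u)| * psi_u(T) = 1, since the predecessors of (T, 1)
    are exactly the last states of the traces ending at u; every other state
    has a single predecessor, left with probability 1, and imposes nothing.
    So stationarity says that psi_u is constant equal to 1 / |T^in(u)|, and as
    psi_u sums to 1 over T^out(u), this constant is also 1 / |T^out(u)|. *)

Require Import Defs.
From mathcomp Require Import all_boot all_order all_algebra.
From mathcomp Require Import all_classical all_reals all_analysis.
From mathcomp Require Import finmap.

Import Order.TTheory GRing.Theory Num.Theory.

Local Open Scope classical_set_scope.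

Section FiniteSums.
Local Open Scope ring_scope.
Local Open Scope fset_scope.
Context {R : realType} {I : choiceType}.
Implicit Types A B : set I.

(** Total masses and inflows below all have this shape: the summand is constant on a finite [B] and
    zero on the rest of [A], so the supremum of partial sums reduces to counting [B]. *)
Lemma esum_const_support A B (k : R) (f : I -> R) :
  finite_set B -> (B `<=` A)%classic -> 0 <= k ->
  (forall i, A i -> f i = if i \in B then k else 0) ->
  (\esum_(i in A) (f i)%:E = (k * (#|` fset_set B|)%:R)%:E)%E.
Proof.
move=> Bfin BA k0 fE.
have -> : (\esum_(i in A) (f i)%:E = \esum_(i in B) k%:E)%E.
  rewrite -(setIidr BA) esum_mkcondr; apply: eq_esum => i Ai.
  by rewrite fE//; case: ifP.
rewrite esum_fset// fsumEFin// fsbig_finite//=.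
by rewrite big_const_seq count_predT iter_addr_0 mulr_natr.
Qed.

Lemma card_fset_set_neq0 A :
  finite_set A -> A !=set0 -> (#|` fset_set A|)%:R != 0 :> R.
Proof.
move=> Afin [i Ai]; rewrite pnatr_eq0 cardfs_eq0; apply/fset0Pn.
by exists i; rewrite in_fset_set// mem_set.
Qed.

Lemma uniform_massE A i : A i ->
  uniform_mass R A i = (#|` fset_set A|)%:R^-1.
Proof. by move=> Ai; rewrite /uniform_mass mem_set// mul1r. Qed.

Lemma uniform_mass_dist A :
  finite_set A -> A !=set0 -> discrete_dist A (uniform_mass R A).
Proof.
move=> Afin A0; split=> [i _|]; first by rewrite /uniform_mass divr_ge0.
rewrite (@esum_const_support A A (#|` fset_set A|)%:R^-1) ?invr_ge0//.
  by rewrite mulVf// card_fset_set_neq0.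
by move=> i Ai; rewrite mem_set// uniform_massE.
Qed.

End FiniteSums.

Section UniformFlow.
Local Open Scope ring_scope.
Local Open Scope fset_scope.
Context {R : realType} {X : choiceType} (D : MTM R X).
Local Notation TT := (mtm_traces D).

Lemma finite_states : finite_set TT -> finite_set (states TT).
Proof.
move=> TTfin.
apply: (@sub_finite_set _ _ (TT `*`` (fun T => `I_(trace_size T)))%classic).
  by move=> [T i] /= [TTT /andP[_ iT]]; split.
exact: finite_setXR.
Qed.

Lemma finite_states_traces : finite_set (states TT) -> finite_set TT.
Proof.
move=> Sfin; apply: sub_finite_set (finite_image fst Sfin) => T TTT.
by exists (T, 1%N).
Qed.

(** Each trace belongs to the outgoing set of its own start, so these sets, indexed by the finite
    set [endpoints TT], cover [TT]. *)
Lemma finite_traces :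
  (forall u, endpoints TT u -> finite_set (traces_out TT u)) -> finite_set TT.
Proof.
move=> outfin; apply: sub_finite_set (bigcup_finite (mtm_finite D) outfin).
by move=> T TTT; exists (trace_start T) => //; exists T.
Qed.

Lemma inflow_first (c : R) T :
  finite_set TT -> 0 <= c -> TT T ->
  (\esum_(s in states TT) (c * mtm_trans D s (T, 1%N))%:E =
   (c * mtm_psi D (trace_start T) T *
     (#|` fset_set (traces_in TT (trace_start T))|)%:R)%:E)%E.
Proof.
move=> TTfin c0 TTT; set u := trace_start T.
have outT : traces_out TT u T by [].
have [psi0 _] := @mtm_dist _ _ D u (ex_intro _ T outT).
have infin : finite_set (traces_in TT u) by apply: sub_finite_set TTfin => ? [].
(* Injectivity of [last_state] makes the number of contributing predecessors equal to the number of
   traces ending at [u]. *)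
pose last_state (T0 : trace X) := (T0, (trace_size T0).-1).
have last_inj : injective last_state by move=> ? ? [].
rewrite (@esum_const_support _ _ _ (last_state @` traces_in TT u)%classic
  (c * mtm_psi D u T)).
- by rewrite fset_set_image// card_imfset.
- exact: finite_image.
- by move=> _ [T0 [TT0 _] <-]; split => /=.
- by rewrite mulr_ge0// psi0.
move=> [T0 i] [/= TT0 /andP[i0 iT0]].
rewrite /mtm_trans /=; case: ltnP => [ltiT0|geiT0].
  (* A move inside a trace lands at index [i.+1], which is at least 2, hence never at [(T, 1)]. *)
  rewrite xpair_eqE eqSS [1%N.-1 == i]eq_sym eqn0Ngt i0 andbF mulr0.
  case: ifP => // /set_mem[T1 _ [eqT eqi]].
  by rewrite -eqi eqT ltnn in ltiT0.
have -> : i = (trace_size T0).-1 by apply/eqP; rewrite eqn_leq iT0.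
rewrite andbT; case: ifPn => [/set_mem[_ startT]|nout].
  by rewrite -startT -/u mem_set//; exists T0.
rewrite mulr0 ifF//; apply: contraNF nout => /set_mem[T1 [_ endT1] [<-]].
by rewrite endT1 mem_set.
Qed.

(** Jumps between traces land at index 1 only, so the whole inflow comes from [(T, i.+1)], which is
    not the last state of [T] because [i.+2] is still a valid index. *)
Lemma inflow_next (c : R) T i :
  0 <= c -> states TT (T, i.+2) ->
  (\esum_(s in states TT) (c * mtm_trans D s (T, i.+2))%:E = c%:E)%E.
Proof.
move=> c0 [/= TTT iT].
rewrite (@esum_const_support _ _ _ [set (T, i.+1)]%classic c)//.
- by rewrite fset_set1 cardfs1 mulr1.
- by move=> _ ->; split => //=; exact: ltnW.
move=> [T0 j] [/= TT0 /andP[j0 jT0]].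
rewrite /mtm_trans /= classical_sets.in_set1 !xpair_eqE eqSS andbF.
case: ltnP => [ltjT0|gejT0].
  by rewrite [T == _]eq_sym [i.+1 == _]eq_sym; case: ifP; rewrite ?mulr1 ?mulr0.
rewrite mulr0; case: ifP => // /andP[/eqP eT /eqP ei].
by move: gejT0; rewrite eT ei leqNgt iT.
Qed.

Lemma uniform_inflow (s' : trace X * nat) :
  (\esum_(s in states TT)
     (uniform_mass R (states TT) s * mtm_trans D s s')%:E =
   \esum_(s in states TT)
     ((#|` fset_set (states TT)|)%:R^-1 * mtm_trans D s s')%:E)%E.
Proof. by apply: eq_esum => s Ss; rewrite uniform_massE. Qed.

End UniformFlow.

Section Theorem5.
Local Open Scope ring_scope.
Local Open Scope fset_scope.
Context {R : realType} {X : choiceType} (D : MTM R X).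
Local Notation TT := (mtm_traces D).

Lemma uniform_stationary_selective_balanced :
  has_uniform_stationary D -> uniformly_selective D /\ balanced D.
Proof.
move=> [Sfin [_ stat]].
have TTfin := finite_states_traces D Sfin.
have outfin u : finite_set (traces_out TT u).
  by apply: sub_finite_set TTfin => ? [].
have infin u : finite_set (traces_in TT u).
  by apply: sub_finite_set TTfin => ? [].
pose n_in u : R := (#|` fset_set (traces_in TT u)|)%:R.
have psi_in u T : traces_out TT u T -> mtm_psi D u T * n_in u = 1.
  move=> [TTT <-]; have ST : states TT (T, 1%N) by split.
  have c0 : (#|` fset_set (states TT)|)%:R^-1 != 0 :> R.
    by rewrite invr_eq0 card_fset_set_neq0//; exists (T, 1%N).
  have := stat _ ST; rewrite uniform_inflow inflow_first ?invr_ge0//.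
  by rewrite uniform_massE// -mulrA => -[]; rewrite -[RHS]mulr1 => /(mulfI c0).
(* Endlessness says that ends are starts; the converse, that some trace ends at [u], comes from the
   product in [psi_in] being 1. *)
have n_in0 u : endpoints TT u -> n_in u != 0.
  move=> [T /psi_in]; apply: contra_eqN => /eqP->.
  by rewrite mulr0 eq_sym oner_eq0.
have psiE u T : traces_out TT u T -> mtm_psi D u T = (n_in u)^-1.
  move=> outT; have nu0 : n_in u != 0 by apply: n_in0; exists T.
  by apply: (mulIf nu0); rewrite psi_in// mulVf.
have cardE u : endpoints TT u ->
    #|` fset_set (traces_in TT u)| = #|` fset_set (traces_out TT u)|.
  move=> uE; have [_] := @mtm_dist _ _ D u uE.
  rewrite (@esum_const_support _ _ _ (traces_out TT u) (n_in u)^-1)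
    ?invr_ge0//; last by move=> T outT; rewrite mem_set// psiE.
  (* The total mass of [mtm_psi D u] is the outgoing count divided by [n_in u]; multiplying by
     [n_in u] leaves an equality of natural numbers cast into [R]. *)
  move=> [/(congr1 (fun x => n_in u * x))].
  by rewrite mulVKf ?n_in0// mulr1 => /eqP; rewrite eqr_nat => /eqP.
split=> u uE; last by apply/fcard_eq => //; exact: cardE.
by split=> // T outT; rewrite uniform_massE// -cardE// psiE.
Qed.

Lemma selective_balanced_uniform_stationary :
  TT !=set0 ->
  uniformly_selective D -> balanced D -> has_uniform_stationary D.
Proof.
move=> [T0 TT0] sel bal.
have TTfin := finite_traces D (fun u uE => (sel u uE).1).
have Sfin := finite_states D TTfin.
(* Without any state the masses would sum to 0 instead of 1. *)
have S0 : states TT !=set0 by exists (T0, 1%N).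
split=> //; split; first exact: uniform_mass_dist.
move=> [T [|[|i]]] ST; first by case: ST.
  have [TTT _] := ST; pose u := trace_start T.
  have outT : traces_out TT u T by [].
  have uE : endpoints TT u by exists T.
  have [outfin psiE] := sel u uE.
  have infin : finite_set (traces_in TT u).
    by apply: sub_finite_set TTfin => ? [].
  rewrite uniform_inflow inflow_first ?invr_ge0// -/u psiE// !uniform_massE//.
  (* Balance replaces the incoming count by the outgoing one, which cancels the denominator of
     [psiE]; it is nonzero since [T] itself starts at [u]. *)
  have /fcard_eq-> // := bal u uE.
  by rewrite divfK// card_fset_set_neq0//; exists T.
by rewrite uniform_inflow inflow_next ?invr_ge0// uniform_massE.
Qed.

End Theorem5.

Theorem theorem5 (R : realType) (X : metricType R) (D : MTM R X) :
  mtm_traces D !=set0 ->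
  has_uniform_stationary D <-> uniformly_selective D /\ balanced D.
Proof.
move=> TT0; split; first exact: uniform_stationary_selective_balanced.
by move=> [sel bal]; exact: selective_balanced_uniform_stationary.
Qed.
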